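(* Let $0<\nu\le1$, $\mu>0$, $n_0\in\mathbb{N}$ with $n_0\ge 1$, and let $\{M^\nu(t),t>0\}$ be the fractional linear death process with death rate intensity $\mu$ and $n_0$ initial individuals. Then for every $t>0$, $$\operatorname{Var} M^\nu(t)=n_0(n_0-1)E_{\nu,1}(-2\mu t^\nu)+n_0E_{\nu,1}(-\mu t^\nu)-n_0^2\big(E_{\nu,1}(-\mu t^\nu)\big)^2 .$$
   Context: The Mittag--Leffler function is $E_{\delta,\beta}(x)=\sum_{j=0}^\infty \frac{x^j}{\Gamma(\delta j+\beta)}$. The fractional linear death process $M^\nu(t)$ takes values in $\{0,1,\ldots,n_0\}$ and its state probabilities $p_k^\nu(t)=\Pr\{M^\nu(t)=k\}$ are the solution of $$\frac{d^\nu}{dt^\nu}p_k^\nu(t)=\mu(k+1)p_{k+1}^\nu(t)-\mu k\,p_k^\nu(t),\quad 0\le k\le n_0,\qquad p_{n_0}^\nu(0)=1,\quad p_k^\nu(0)=0\ \text{ for } 0\le k<n_0,$$ with the convention $p_{n_0+1}^\nu\equiv0$, where $\frac{d^\nu}{dt^\nu}$ is the Caputo fractional derivative of order $\nu$ (the ordinary derivative if $\nu=1$). *)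

(* Defs.v *)
From HB Require Import structures.
From mathcomp Require Import all_boot all_order all_algebra.
From mathcomp Require Import all_classical all_reals all_analysis.

Set Implicit Arguments.
Unset Strict Implicit.
Unset Printing Implicit Defensive.

Import Order.TTheory GRing.Theory Num.Theory.
Import numFieldNormedType.Exports.

Local Open Scope classical_set_scope.
Local Open Scope ring_scope.

(* Euler's integral; it is the Gamma function only for a > 0, the only range
   in which it is used below (arguments delta * j + beta and 1 - nu). *)
Definition Gamma (R : realType) (a : R) : R :=
  \int[@lebesgue_measure R]_(x in `]0, +oo[) (x `^ (a - 1) * expR (- x)).

Definition mittag_leffler (R : realType) (delta beta x : R) : R :=
  limn (series (fun j : nat => x ^+ j / Gamma (delta * j%:R + beta))).

(* f is absolutely continuous on every [0, b]: it is the primitive of a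
   Lebesgue integrable function. *)
Definition locally_abs_continuous (R : realType) (f : R -> R) : Prop :=
  exists phi : R -> R, forall b : R, 0 < b ->
    (@lebesgue_measure R).-integrable `[0, b] (EFin \o phi) /\
    f b = f 0 + \int[@lebesgue_measure R]_(s in `[0, b]) phi s.

Definition caputo_integrand (R : realType) (nu : R) (f : R -> R) (t s : R) : R :=
  (t - s) `^ (- nu) * derive1 f s.

(* Caputo derivative of order 0 < nu <= 1 with base point 0. For nu < 1, an
   absolutely continuous f is differentiable almost everywhere, so that the
   value chosen by derive1 f at the remaining points is irrelevant. *)
Definition caputo (R : realType) (nu : R) (f : R -> R) (t : R) : R :=
  if nu == 1 then derive1 f t
  else (Gamma (1 - nu))^-1 *
       \int[@lebesgue_measure R]_(s in `]0, t[) caputo_integrand nu f t s.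

(* Existence of the Caputo derivative at t: derive1 f and the
   integral above are total operators, with arbitrary values otherwise. *)
Definition caputo_derivable (R : realType) (nu : R) (f : R -> R) (t : R) : Prop :=
  if nu == 1 then derivable f t 1
  else (@lebesgue_measure R).-integrable `]0, t[
         (EFin \o caputo_integrand nu f t).

(* p k t stands for p_k(t), t >= 0; values at negative times play no role.
   Solutions are sought among the locally absolutely continuous functions on
   [0, +oo[, the usual domain of the Caputo derivative of order <= 1. *)
Definition fractional_death_system (R : realType) (nu mu : R) (n0 : nat)
    (p : nat -> R -> R) : Prop :=
  [/\ forall k, (k <= n0)%N -> locally_abs_continuous (p k),
      forall k t, (k <= n0)%N -> 0 < t ->
        caputo_derivable nu (p k) t /\
        caputo nu (p k) t = mu * k.+1%:R * p k.+1 t - mu * k%:R * p k t,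
      forall t, 0 <= t -> p n0.+1 t = 0,
      p n0 0 = 1
    & forall k, (k < n0)%N -> p k 0 = 0].

Definition state_probability d (T : measurableType d) (R : realType)
    (P : probability T R) (M : R -> {RV P >-> R}) (k : nat) (t : R) : R :=
  fine (P [set w | M t w = k%:R]).

Definition fractional_linear_death_process d (T : measurableType d)
    (R : realType) (P : probability T R) (nu mu : R) (n0 : nat)
    (M : R -> {RV P >-> R}) : Prop :=
  (forall t w, 0 <= t -> exists2 k : nat, (k <= n0)%N & M t w = k%:R) /\
  fractional_death_system nu mu n0 (state_probability M).

(* Main.v *)
Require Import Defs.
From HB Require Import structures.
From mathcomp Require Import all_boot all_order all_algebra.
From mathcomp Require Import all_classical all_reals all_analysis.
From mathcomp Require Import measurable_realfun ring lra.
Import Order.TTheory GRing.Theory Num.Theory.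
Import numFieldNormedType.Exports.
Local Open Scope classical_set_scope.
Local Open Scope ring_scope.

(* Let I^a be the Riemann-Liouville integral, i.e. the convolution with
   x^(a-1) / Gamma(a) on x > 0. By Tonelli and the Beta integral,
   I^a I^b = I^(a+b). Applying I^nu to D^nu f = r, where
   D^nu f = I^(1-nu) f', yields the Volterra equation f - f(0) = I^nu r.
   The first two factorial moments g of the death process are nonnegative
   and solve g + lam I^nu g = g(0) with lam = mu, 2 mu. Applying I^(n nu),
     u_n + lam u_(n+1) = g(0) t^(n nu) / Gamma(n nu + 1), u_n := (I^(n nu) g)(t),
   so that the Mittag-Leffler partial sums telescope to
   g(t) - (-lam)^n u_n, and 0 <= u_n <= g(0) t^(n nu) / Gamma(n nu + 1) makes
   the remainder vanish. The variance is a combination of these moments. *)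

(** * Convolution with a nonnegative kernel *)

Section affine_substitution.
Context {R : realType}.
Notation mu := (@lebesgue_measure R).
Local Open Scope ereal_scope.

(** Lebesgue measure is [a] times its image under x -> a x + b: by uniqueness this only has to be
    checked on half-open intervals. *)
Lemma ge0_integral_affine (a b : R) (f : R -> \bar R) : (0 < a)%R ->
  measurable_fun setT f -> (forall x, 0 <= f x) ->
  \int[mu]_x f x = a%:E * \int[mu]_x f (a * x + b)%R.
Proof.
move=> a0 mf f0; pose phi (x : measurableTypeR R) : measurableTypeR R := (a * x + b)%R.
have mphi : measurable_fun setT phi.
  by apply: measurable_funD => //; exact: measurable_funM.
pose m : {measure set (measurableTypeR R) -> \bar R} :=
  mscale (NngNum (ltW a0)) (pushforward mu phi).
have muE A : measurable A -> mu A = m mphi A.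
  apply: lebesgue_measure_unique => X [[u v]] _ <-.
  rewrite /m/= /mscale/= /pushforward.
  have -> : phi @^-1` `]u, v]%classic = `](u - b) / a, (v - b) / a]%classic%R.
    apply/seteqP; split => x /=; rewrite /phi !in_itv/= ltr_pdivrMr// ler_pdivlMr//;
     by rewrite ltrBlDr lerBrDr (mulrC x).
  rewrite !lebesgue_measure_itv/= !lte_fin ltr_pM2r ?invr_gt0// ltrD2r.
  case: ifPn => _; last by rewrite mule0.
  rewrite -!EFinB -EFinM; congr (_%:E); rewrite -mulrBl.
  by rewrite mulrCA divff ?gt_eqF// mulr1 opprB addrA subrK.
rewrite (@eq_measure_integral _ _ _ _ (m mphi)); last by move=> A mA _; exact: muE.
rewrite ge0_integral_mscale//=; congr (_ * _).
by rewrite ge0_integral_pushforward.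
Qed.

Lemma ge0_integral_shift (b : R) (f : R -> \bar R) :
  measurable_fun setT f -> (forall x, 0 <= f x) ->
  \int[mu]_x f (x + b)%R = \int[mu]_x f x.
Proof.
move=> mf f0; rewrite (@ge0_integral_affine 1 b f)// mul1e.
by apply: eq_integral => x _; rewrite mul1r.
Qed.

End affine_substitution.

(** Integrating over the whole line with extended values lets Tonelli apply without integrability
    conditions; the range []0, t[] is recovered when [k] and [F] vanish on x <= 0. *)
Definition convolution {R : realType} (k : R -> R) (F : R -> \bar R) (t : R) : \bar R :=
  (\int[@lebesgue_measure R]_s ((k (t - s))%:E * F s))%E.

Section convolution.
Context {R : realType}.
Notation mu := (@lebesgue_measure R).
Local Open Scope ereal_scope.
Implicit Types (k l : R -> R) (F G : R -> \bar R).

Lemma convolution_ge0 k F t : (forall x, 0 <= k x)%R -> (forall x, 0 <= F x) ->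
  0 <= convolution k F t.
Proof. by move=> k0 F0; apply: integral_ge0 => s _; rewrite mule_ge0// lee_fin. Qed.

Let mR := measurableTypeR R.

Let measurable_kernel2 k F : measurable_fun setT k -> measurable_fun setT F ->
  measurable_fun setT (fun z : mR * mR => (k (z.1 - z.2))%:E * F z.2).
Proof.
move=> mk mF; apply: emeasurable_funM.
  apply/measurable_EFinP; apply: (measurableT_comp mk).
  exact: measurable_funB.
exact: (measurableT_comp mF).
Qed.

Lemma measurable_convolution k F :
  measurable_fun setT k -> measurable_fun setT F ->
  (forall x, 0 <= k x)%R -> (forall x, 0 <= F x) ->
  measurable_fun setT (convolution k F).
Proof.
move=> mk mF k0 F0.
apply: (@measurable_fun_fubini_tonelli_F _ _ mR mR R mu
  (fun z : mR * mR => (k (z.1 - z.2))%:E * F z.2)).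
  exact: measurable_kernel2.
by move=> z; rewrite mule_ge0// lee_fin.
Qed.

Lemma measurable_convolution_integrand k F t :
  measurable_fun setT k -> measurable_fun setT F ->
  measurable_fun setT (fun s : R => (k (t - s))%:E * F s).
Proof.
move=> mk mF; apply: emeasurable_funM => //.
by apply/measurable_EFinP/(measurableT_comp mk); exact: measurable_funB.
Qed.

Lemma convolutionD k F G t : measurable_fun setT k ->
  measurable_fun setT F -> measurable_fun setT G ->
  (forall x, 0 <= k x)%R -> (forall x, 0 <= F x) -> (forall x, 0 <= G x) ->
  convolution k (F \+ G) t = convolution k F t + convolution k G t.
Proof.
move=> mk mF mG k0 F0 G0; rewrite /convolution -ge0_integralD//.
- by apply: eq_integral => s _; rewrite ge0_muleDr.
- by move=> s _; rewrite mule_ge0// lee_fin.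
- exact: measurable_convolution_integrand.
- by move=> s _; rewrite mule_ge0// lee_fin.
- exact: measurable_convolution_integrand.
Qed.

Lemma convolutionZr (c : R) k F t : measurable_fun setT k ->
  measurable_fun setT F -> (forall x, 0 <= k x)%R -> (forall x, 0 <= F x) ->
  (0 <= c)%R -> convolution k (fun s => c%:E * F s) t = c%:E * convolution k F t.
Proof.
move=> mk mF k0 F0 c0; rewrite /convolution -ge0_integralZl_EFin//.
- by apply: eq_integral => s _; rewrite muleCA.
- by move=> s _; rewrite mule_ge0// lee_fin.
- exact: measurable_convolution_integrand.
Qed.

Lemma convolutionZl (c : R) k F t : measurable_fun setT k ->
  measurable_fun setT F -> (forall x, 0 <= k x)%R -> (forall x, 0 <= F x) ->
  (0 <= c)%R -> convolution (fun s => c * k s)%R F t = c%:E * convolution k F t.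
Proof.
move=> mk mF k0 F0 c0; rewrite -convolutionZr//.
by rewrite /convolution; apply: eq_integral => s _; rewrite EFinM -muleA muleCA.
Qed.

(** Tonelli swaps the two integrals, and a translation by [r] turns the inner one into the
    convolution of the kernels. The latter is supplied as a real function [kl] because kernels are
    real-valued. *)
Lemma convolutionA k l (kl : R -> R) F t :
  measurable_fun setT k -> measurable_fun setT l -> measurable_fun setT F ->
  (forall x, 0 <= k x)%R -> (forall x, 0 <= l x)%R -> (forall x, 0 <= F x) ->
  (forall x, convolution k (EFin \o l) x = (kl x)%:E) ->
  convolution k (convolution l F) t = convolution kl F t.
Proof.
move=> mk ml mF k0 l0 F0 klE.
transitivity (\int[mu]_s \int[mu]_r
    ((k (t - s))%:E * ((l (s - r))%:E * F r))).
  apply: eq_integral => s _; rewrite ge0_integralZl_EFin//.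
    by move=> r _; rewrite mule_ge0// lee_fin.
  exact: measurable_convolution_integrand.
rewrite (@fubini_tonelli _ _ mR mR R mu mu
  (fun z : mR * mR => (k (t - z.1))%:E * ((l (z.1 - z.2))%:E * F z.2))); last 2 first.
- apply: emeasurable_funM; last exact: measurable_kernel2.
  by apply/measurable_EFinP/(measurableT_comp mk); exact: measurable_funB.
- by move=> z; rewrite !mule_ge0// lee_fin.
apply: eq_integral => r _ /=; rewrite -klE.
transitivity (F r * \int[mu]_s ((k (t - s))%:E * (l (s - r))%:E)).
  rewrite -ge0_integralZl//.
  - by apply: eq_integral => s _; rewrite muleA muleC.
  - apply: emeasurable_funM.
      by apply/measurable_EFinP/(measurableT_comp mk); exact: measurable_funB.
    by apply/measurable_EFinP/(measurableT_comp ml); exact: measurable_funB.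
  - by move=> s _; rewrite mule_ge0// lee_fin.
rewrite muleC; congr (_ * _).
rewrite -[LHS](@ge0_integral_shift R r).
- by apply: eq_integral => s _ /=; rewrite addrK opprD (addrC (- s)%R) addrA.
- apply: emeasurable_funM.
    by apply/measurable_EFinP/(measurableT_comp mk); exact: measurable_funB.
  by apply/measurable_EFinP/(measurableT_comp ml); exact: measurable_funB.
- by move=> s; rewrite mule_ge0// lee_fin.
Qed.

(** Tonelli again: for fixed [s] the integral of k(t - s) in [t] is independent of [s] by
    translation invariance. *)
Lemma integral_convolution k F :
  measurable_fun setT k -> measurable_fun setT F ->
  (forall x, 0 <= k x)%R -> (forall x, 0 <= F x) ->
  \int[mu]_t convolution k F t = (\int[mu]_x (k x)%:E) * \int[mu]_x F x.
Proof.
move=> mk mF k0 F0.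
rewrite (@fubini_tonelli _ _ mR mR R mu mu
  (fun z : mR * mR => (k (z.1 - z.2))%:E * F z.2)); last 2 first.
- exact: measurable_kernel2.
- by move=> z; rewrite mule_ge0// lee_fin.
rewrite -ge0_integralZl//; last by apply: integral_ge0 => x _; rewrite lee_fin.
apply: eq_integral => s _ /=; rewrite muleC.
under eq_integral do rewrite muleC.
rewrite ge0_integralZl//.
- congr (_ * _); rewrite -[RHS](@ge0_integral_shift R (- s) (EFin \o k))//.
  + exact/measurable_EFinP.
- by apply/measurable_EFinP/(measurableT_comp mk); exact: measurable_funB.
- by move=> x _; rewrite lee_fin.
Qed.

End convolution.

(** * The Beta and Gamma integrals *)

(** The guard discards the conventional values of the total power function at x <= 0. *)
Definition power_kernel {R : realType} (a x : R) : R :=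
  if 0 < x then x `^ (a - 1) else 0.

(** This is the integral of (1 - s)^(a-1) s^(b-1) over 0 < s < 1, the guards in both kernels cutting
    the line down to that interval. *)
Definition Beta {R : realType} (a b : R) : \bar R :=
  convolution (power_kernel a) (EFin \o power_kernel b) 1.

Section power_kernel.
Context {R : realType}.
Notation mu := (@lebesgue_measure R).
Implicit Types a b x : R.

Lemma measurable_power_kernel a : measurable_fun setT (power_kernel a).
Proof.
apply: measurable_fun_ifT => //; exact: measurable_fun_ltr.
Qed.

Lemma power_kernel_ge0 a x : 0 <= power_kernel a x.
Proof. by rewrite /power_kernel; case: ifPn => // _; exact: powR_ge0. Qed.

Lemma power_kernel_le0 a {x} : x <= 0 -> power_kernel a x = 0.
Proof. by move=> x0; rewrite /power_kernel ltNge x0. Qed.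

Lemma power_kernelE a {x} : 0 < x -> power_kernel a x = x `^ (a - 1).
Proof. by rewrite /power_kernel => ->. Qed.

Lemma power_kernel_scale a x {c} : 0 < c ->
  power_kernel a (c * x) = c `^ (a - 1) * power_kernel a x.
Proof.
move=> c0; rewrite /power_kernel pmulr_rgt0//; case: ifPn => x0; last by rewrite mulr0.
by rewrite powRM// ltW.
Qed.

Local Open Scope ereal_scope.

Lemma convolution_itv (k : R -> R) (F : R -> \bar R) t :
  (forall x, (x <= 0)%R -> k x = 0%R) ->
  (forall s, (s <= 0)%R -> F s = 0) ->
  convolution k F t = \int[mu]_(s in `]0%R, t[) ((k (t - s)%R)%:E * F s).
Proof.
move=> k0 F0; rewrite integral_mkcond; apply: eq_integral => s _.
rewrite patchE; case: ifPn => //.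
rewrite notin_setE/= in_itv/= => /negP; rewrite negb_and -!leNgt => /orP[s0|ts].
  by rewrite F0// mule0.
by rewrite k0 ?mul0e// subr_le0.
Qed.

(** The substitution s = t x and homogeneity of the kernels produce t t^(a-1) t^(b-1). For t <= 0
    both sides vanish, even if [Beta a b] is infinite, since infinity times 0 is 0. *)
Lemma convolution_power_kernel a b t :
  convolution (power_kernel a) (EFin \o power_kernel b) t =
  Beta a b * (power_kernel (a + b)%R t)%:E.
Proof.
have [t0|t0] := leP t 0%R.
  rewrite (power_kernel_le0 _ t0) mule0 convolution_itv.
  - by rewrite set_itv_ge ?integral_set0// bnd_simp -leNgt.
  - by move=> x; exact: power_kernel_le0.
  - by move=> x x0 /=; rewrite power_kernel_le0.
rewrite /convolution (@ge0_integral_affine _ t 0)//; last 2 first.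
- apply: measurable_convolution_integrand; first exact: measurable_power_kernel.
  by apply/measurable_EFinP; exact: measurable_power_kernel.
- by move=> s; rewrite mule_ge0// lee_fin power_kernel_ge0.
rewrite power_kernelE//.
have -> : (t `^ (a + b - 1) = t * (t `^ (a - 1) * t `^ (b - 1)))%R.
  have tn0 : t != 0%R by rewrite gt_eqF.
  have -> : (a + b - 1 = 1 + ((a - 1) + (b - 1)))%R by ring.
  by rewrite !powRD ?tn0 ?implybT// powRr1// ltW.
rewrite EFinM muleCA; congr (_ * _).
rewrite muleC /Beta /convolution -ge0_integralZl_EFin//.
- apply: eq_integral => s _ /=; rewrite addr0.
  rewrite -{1}[t]mulr1 -mulrBr !power_kernel_scale// -!EFinM; congr (_%:E).
  by rewrite mulrACA.
- by move=> s _; rewrite mule_ge0// lee_fin power_kernel_ge0.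
- apply: measurable_convolution_integrand; first exact: measurable_power_kernel.
  by apply/measurable_EFinP; exact: measurable_power_kernel.
- by rewrite mulr_ge0// powR_ge0.
Qed.

(** The first kernel is 1 on []0, 1[], so x^(a-1) is integrated. It may blow up at 0, hence the
    fundamental theorem is applied away from 0 and monotone convergence does the rest. *)
Lemma Beta1l a : (0 < a)%R -> Beta 1 a = (a^-1)%:E.
Proof.
move=> a0; rewrite /Beta convolution_itv; last 2 first.
- by move=> x; exact: power_kernel_le0.
- by move=> x x0 /=; rewrite power_kernel_le0.
transitivity (\int[mu]_(x in `]0%R, 1%R]) (x `^ (a - 1))%:E).
  rewrite -integral_itv_bndo_bndc; last first.
    by apply/measurable_EFinP/measurable_funTS; exact: measurable_powR.
  apply: eq_integral => x; rewrite inE/= in_itv/= => /andP[x0 x1].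
  by rewrite !power_kernelE ?subr_gt0// subrr powRr0 mul1e.
(* Starting at 1/2 rather than 1 keeps every interval nondegenerate, as [continuous_FTC2]
   requires. *)
pose F n := `[(n.+2%:R)^-1%R, 1%R]%classic : set R.
have FE : \bigcup_n F n = `]0%R, 1%R]%classic.
  apply/seteqP; split => x /=.
    move=> [n _]; rewrite /F/= !in_itv/= => /andP[nx ->]; rewrite andbT.
    by rewrite (lt_le_trans _ nx)// invr_gt0.
  rewrite in_itv/= => /andP[x0 x1]; exists (Num.truncn x^-1) => //=.
  rewrite /F /= in_itv/= x1 andbT -[leRHS]invrK lef_pV2 ?posrE ?invr_gt0//.
  rewrite (le_trans (ltW (truncnS_gt _)))// ler_nat ltnS; exact: leqnSn.
have intF n : \int[mu]_(x in F n) (x `^ (a - 1))%:E =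
    (a^-1 - a^-1 * (n.+2%:R)^-1 `^ a)%R%:E.
  have n0 : (0 < (n.+2%:R)^-1 :> R)%R by rewrite invr_gt0.
  have dF x : (0 < x)%R -> is_derive x 1%R (fun y => a^-1 * y `^ a)%R (x `^ (a - 1))%R.
    move=> x0; have := is_derive1_powR a x0 => dx.
    have : is_derive x 1%R (fun y => a^-1 * y `^ a)%R (a^-1 *: (a * x `^ (a - 1)))%R.
      exact: is_deriveZ.
    by rewrite scalerA mulVf ?scale1r// gt_eqF.
  have cF x : (0 < x)%R -> {for x, continuous (fun y => a^-1 * y `^ a)%R}.
    move=> x0; apply: differentiable_continuous; apply/derivable1_diffP.
    by have [] := dF x x0.
  rewrite (@continuous_FTC2 _ _ (fun y => a^-1 * y `^ a)%R).
  - by rewrite powR1 mulr1.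
  - by rewrite invf_lt1// ltr1n.
  - apply: derivable_within_continuous => x; rewrite in_itv/= => /andP[nx _].
    by apply: derivable_powR; rewrite in_itv/= andbT (lt_le_trans _ nx).
  - split.
    + move=> x; rewrite in_itv/= => /andP[nx _].
      by have [] := dF x (lt_trans n0 nx).
    + by apply: cvg_at_right_filter; exact: cF.
    + by apply: cvg_at_left_filter; exact: cF.
  - move=> x; rewrite in_itv/= => /andP[nx _].
    by rewrite derive1E; have [_ ->] := dF x (lt_trans n0 nx).
have := @ge0_nondecreasing_set_cvg_integral _ (measurableTypeR R) R F
  (fun x => (x `^ (a - 1))%:E) mu.
rewrite FE => /(_ _ _ _ _)/cvg_lim <- //; last 4 first.
- move=> m n mn; apply/subsetPset; apply: subset_itvr.
  by rewrite bnd_simp lef_pV2 ?posrE// ler_nat !ltnS.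
- by move=> n; exact: measurable_itv.
- by move=> n; apply/measurable_EFinP/measurable_funTS; exact: measurable_powR.
- by move=> n x _; rewrite lee_fin powR_ge0.
apply/cvg_lim => //.
rewrite (_ : (fun n => _) = EFin \o (fun n => a^-1 - a^-1 * (n.+2%:R)^-1 `^ a)%R); last first.
  by apply/funext => n /=; rewrite intF.
apply: cvg_EFin; first exact: nearW.
rewrite -[X in _ --> X]subr0; apply: cvgB; first exact: cvg_cst.
rewrite -[X in _ --> X](mulr0 a^-1%R); apply: cvgM; first exact: cvg_cst.
apply: ((cvg_at_rightP (fun x => x `^ a)%R 0 0).1 (powR_cvg0 a0)); split.
  by move=> n; rewrite invr_gt0.
have := @cvg_harmonic R; rewrite -cvg_shiftS; exact.
Qed.

End power_kernel.

(** * The Gamma function: functional equation, finiteness, lower bound *)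

Section gamma.
Context {R : realType}.
Notation mu := (@lebesgue_measure R).
Implicit Types a b x : R.

Let gamma_density a x : R := expR (- x) * power_kernel a x.

Let gamma_density_ge0 a x : 0 <= gamma_density a x.
Proof. by rewrite mulr_ge0 ?expR_ge0// power_kernel_ge0. Qed.

Let measurable_expRN : measurable_fun [set: R] (fun x => expR (- x)).
Proof.
apply: continuous_measurable_fun => x.
by apply: continuous_comp; [exact: continuousN|exact: continuous_expR].
Qed.

Let measurable_gamma_density a : measurable_fun setT (gamma_density a).
Proof.
by apply: measurable_funM; last exact: measurable_power_kernel.
Qed.

Local Open Scope ereal_scope.

Let measurable_gamma_densityE a (D : set (measurableTypeR R)) :
  measurable_fun D (fun x => (gamma_density a x)%:E).
Proof.
apply/measurable_EFinP; apply: measurable_funTS; exact: measurable_gamma_density.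
Qed.

(* Extended-valued, so that Tonelli applies before finiteness is known. *)
Let eGamma a : \bar R := \int[mu]_x (gamma_density a x)%:E.

Let eGamma_ge0 a : 0 <= eGamma a.
Proof. by apply: integral_ge0 => x _; rewrite lee_fin. Qed.

Let GammaE a : Gamma a = fine (eGamma a).
Proof.
rewrite /Gamma /Rintegral integral_mkcond; congr fine.
apply: eq_integral => x _; rewrite patchE /gamma_density /power_kernel.
rewrite mem_setE in_itv/= andbT.
by case: ifPn; rewrite ?mulr0// mulrC.
Qed.

(** The product of the integrals is the integral of the convolution of the densities. Since
    e^(-(x-y)) e^(-y) = e^(-x) leaves the inner integral, a convolution of power kernels remains. *)
Let eGammaM a b : eGamma a * eGamma b = Beta a b * eGamma (a + b)%R.
Proof.
rewrite /eGamma -integral_convolution//; last 2 first.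
- exact: measurable_gamma_densityE.
- by move=> x; rewrite lee_fin.
rewrite -ge0_integralZl//; last 2 first.
- by move=> x _; rewrite lee_fin.
- by apply: convolution_ge0 => x; rewrite ?lee_fin power_kernel_ge0.
apply: eq_integral => x _.
rewrite EFinM muleCA -convolution_power_kernel /convolution.
rewrite -ge0_integralZl_EFin ?expR_ge0//.
- apply: eq_integral => y _ /=; rewrite /gamma_density -!EFinM; congr (_%:E).
  by rewrite mulrACA -expRD addrC opprB addKr mulrA.
- by move=> y _; rewrite mule_ge0// lee_fin power_kernel_ge0.
- apply: measurable_convolution_integrand; first exact: measurable_power_kernel.
  by apply/measurable_EFinP; exact: measurable_power_kernel.
Qed.

Let eGamma1 : eGamma 1 = 1.
Proof.
rewrite -(@integral_exponential_pdf R 1)// /eGamma.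
transitivity (\int[mu]_(x in `]0%R, +oo[) (expR (- x))%:E).
  rewrite [RHS]integral_mkcond; apply: eq_integral => x _.
  rewrite patchE /gamma_density /power_kernel mem_setE in_itv/= andbT.
  by case: ifPn; rewrite ?mulr0// subrr powRr0 mulr1.
rewrite integral_itv_obnd_cbnd; last first.
  by apply/measurable_EFinP/measurable_funTS; exact: measurable_expRN.
rewrite integral_mkcond; apply: eq_integral => x _.
rewrite patchE /exponential_pdf patchE; case: ifPn => // _.
by rewrite mul1r mulN1r.
Qed.

(* The functional equation, with no integration by parts: it is eGammaM at (1, a). *)
Let eGammaS a : (0 < a)%R -> eGamma a = a^-1%:E * eGamma (1 + a)%R.
Proof. by move=> a0; rewrite -Beta1l// -eGammaM eGamma1 mul1e. Qed.

(** For 0 < b <= 1 the density is at most x^(b-1) when x < 1 and at most e^(-x) when x >= 1; these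
    bounds integrate to at most [Beta 1 b] and [eGamma 1]. The functional equation then reaches
    larger arguments by unit steps. *)
Let eGamma_fin a : (0 < a)%R -> eGamma a \is a fin_num.
Proof.
have base b : (0 < b <= 1)%R -> eGamma b < +oo.
  move=> /andP[b0 b1]; apply: (@le_lt_trans _ _ (Beta 1 b + eGamma 1)).
    have mB : measurable_fun [set: measurableTypeR R] (fun x : R =>
        (power_kernel 1 (1 - x))%:E * (power_kernel b x)%:E).
      apply: measurable_convolution_integrand; first exact: measurable_power_kernel.
      by apply/measurable_EFinP; exact: measurable_power_kernel.
    rewrite /Beta /convolution /eGamma -ge0_integralD//; last 2 first.
    - by move=> x _; rewrite mule_ge0// lee_fin power_kernel_ge0.
    - by move=> x _; rewrite lee_fin.
    apply: ge0_le_integral => //.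
    - by move=> x _; rewrite lee_fin.
    - by apply: emeasurable_funD => //; exact: measurable_gamma_densityE.
    - move=> x _; rewrite -EFinM -EFinD lee_fin /gamma_density /power_kernel.
      have [x0|x0] := ltP 0%R x; last by rewrite !mulr0 addr0.
      rewrite subr_gt0 subrr !powRr0 mulr1; case: ltP => x1.
        rewrite mul1r (@le_trans _ _ (x `^ (b - 1))%R)//.
          by rewrite ler_piMl ?powR_ge0// -expR0 ler_expR oppr_le0 ltW.
        by rewrite lerDl expR_ge0.
      rewrite mul0r add0r ler_piMr ?expR_ge0//.
      by rewrite -[leRHS](powRr0 x) ler_powR// subr_le0.
  by rewrite Beta1l// eGamma1 ltry.
have fin n : forall b, (0 < b <= n.+1%:R)%R -> eGamma b < +oo.
  elim: n => [//|n IH] b /andP[b0 bn].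
  have [b1|b1] := leP b 1%R; first by rewrite base// b0.
  have b10 : (0 < b - 1)%R by rewrite subr_gt0.
  have := eGammaS _ b10; rewrite (addrC 1%R) subrK => eb.
  have: eGamma (b - 1) < +oo by apply: IH; rewrite b10/= lerBlDr natr1.
  rewrite eb => bfin; rewrite ltey; apply/eqP => gy; move: bfin.
  by rewrite gy gt0_muley// lte_fin invr_gt0.
move=> a0; rewrite ge0_fin_numE//; apply: (fin (Num.truncn a)).
by rewrite a0/= ltW// truncnS_gt.
Qed.

(** Only the part of the integral over [[K, K + 1]], an interval of length 1, is kept. As [K] is
    free, [Gamma] outgrows every geometric sequence. *)
Lemma Gamma_ge {K a : R} : (0 < K)%R -> (1 <= a)%R ->
  (K `^ (a - 1) * expR (- (K + 1)) <= Gamma a)%R.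
Proof.
move=> K0 a1; have a0 : (0 < a)%R by exact: lt_le_trans a1.
rewrite -lee_fin GammaE fineK ?eGamma_fin// /eGamma.
have mg (D : set (measurableTypeR R)) : measurable_fun D (EFin \o gamma_density a).
  exact: measurable_gamma_densityE.
have g0 x : 0 <= (EFin \o gamma_density a) x by rewrite lee_fin.
apply: (@le_trans _ _ (\int[mu]_(x in `[K, (K + 1)%R]) (gamma_density a x)%:E)); last first.
  by apply: (@ge0_subset_integral _ (measurableTypeR R) _ mu _ _ _ _ (EFin \o gamma_density a)).
rewrite -[leLHS]mule1.
have -> : 1 = mu `[K, (K + 1)%R].
  by rewrite lebesgue_measure_itv/= lte_fin ltrDl ltr01 -EFinB addrC addKr.
rewrite -integral_cst//; apply: ge0_le_integral => //.
- by move=> x _; rewrite lee_fin mulr_ge0 ?powR_ge0 ?expR_ge0.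
- move=> x /=; rewrite in_itv/= => /andP[Kx xK].
  have x0 : (0 < x)%R by exact: lt_le_trans Kx.
  rewrite lee_fin /gamma_density power_kernelE// mulrC.
  apply: ler_pM; rewrite ?expR_ge0 ?powR_ge0 ?ler_expR ?lerN2//.
  by apply: ge0_ler_powR; rewrite ?nnegrE ?subr_ge0// ltW.
Qed.

Lemma Gamma_gt0 {a} : (0 < a)%R -> (0 < Gamma a)%R.
Proof.
move=> a0; rewrite GammaE fine_gt0//; apply/andP; split; last first.
  by rewrite ltey_eq eGamma_fin.
(* Passing to 1 + a brings the argument into the range of [Gamma_ge]. *)
rewrite eGammaS// mule_gt0 ?lte_fin ?invr_gt0//.
have a10 : (0 < 1 + a)%R by rewrite addr_gt0.
rewrite -[ltRHS]fineK ?eGamma_fin// lte_fin -GammaE.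
apply: (@lt_le_trans _ _ (1 `^ (1 + a - 1) * expR (- (1 + 1))))%R.
  by rewrite mulr_gt0 ?expR_gt0// powR_gt0.
by rewrite Gamma_ge// lerDl ltW.
Qed.

Lemma Gamma1 : Gamma (1 : R) = 1%R.
Proof. by rewrite GammaE eGamma1. Qed.

(** In [eGammaM] all three Gamma integrals are finite and positive, so an infinite [Beta a b] would
    make the finite left side infinite. *)
Lemma BetaE a b : (0 < a)%R -> (0 < b)%R ->
  Beta a b = (Gamma a * Gamma b / Gamma (a + b))%R%:E.
Proof.
move=> a0 b0; have ab0 : (0 < a + b)%R by exact: addr_gt0.
have := eGammaM a b.
rewrite -(fineK (eGamma_fin _ a0)) -(fineK (eGamma_fin _ b0)).
rewrite -(fineK (eGamma_fin _ ab0)) -!GammaE => eab.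
have : 0 < (Gamma (a + b))%:E by rewrite lte_fin Gamma_gt0.
have : 0 <= Beta a b by apply: convolution_ge0 => x; rewrite ?lee_fin power_kernel_ge0.
case: (Beta a b) eab => [r| |]//.
- move=> + _ G0; rewrite -!EFinM => -[->]; rewrite mulfK//.
  by rewrite gt_eqF// Gamma_gt0.
- by move=> + _ G0; rewrite gt0_mulye.
Qed.

End gamma.

(** * Riemann-Liouville kernels and their semigroup law *)

Definition rl_kernel {R : realType} (a x : R) : R := (Gamma a)^-1 * power_kernel a x.

Section rl_kernel.
Context {R : realType}.
Implicit Types a b x : R.

Lemma measurable_rl_kernel a : measurable_fun setT (rl_kernel a).
Proof. by apply: measurable_funM => //; exact: measurable_power_kernel. Qed.

Lemma rl_kernel_le0 a {x} : x <= 0 -> rl_kernel a x = 0.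
Proof. by move=> x0; rewrite /rl_kernel power_kernel_le0 ?mulr0. Qed.

Lemma rl_kernel_ge0 a x : 0 < a -> 0 <= rl_kernel a x.
Proof. by move=> a0; rewrite mulr_ge0 ?power_kernel_ge0// invr_ge0 ltW// Gamma_gt0. Qed.

(** Order 1 gives the Heaviside function, so that convolving with it is taking the primitive from 0
    of functions that vanish on x <= 0. *)
Lemma rl_kernel1 x : rl_kernel 1 x = (0 < x)%R%:R.
Proof.
rewrite /rl_kernel Gamma1 invr1 mul1r /power_kernel subrr powRr0.
by case: ifP.
Qed.

Lemma convolution_rl_kernel a b t : 0 < a -> 0 < b ->
  convolution (rl_kernel a) (EFin \o rl_kernel b) t = (rl_kernel (a + b) t)%:E.
Proof.
move=> a0 b0; have Ga := Gamma_gt0 a0; have Gb := Gamma_gt0 b0.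
have Gab := Gamma_gt0 (addr_gt0 a0 b0).
have mk (c : R) : measurable_fun setT (EFin \o power_kernel c).
  by apply/measurable_EFinP; exact: measurable_power_kernel.
have k0 (c x : R) : (0 <= (EFin \o power_kernel c) x)%E.
  by rewrite lee_fin power_kernel_ge0.
rewrite convolutionZl ?invr_ge0 ?(ltW Ga)//; last 4 first.
- exact: measurable_power_kernel.
- by apply/measurable_EFinP; exact: measurable_rl_kernel.
- by move=> x; exact: power_kernel_ge0.
- by move=> x; rewrite lee_fin rl_kernel_ge0.
rewrite (_ : EFin \o rl_kernel b =
    fun s => ((Gamma b)^-1%:E * (EFin \o power_kernel b) s)%E); last first.
  by apply/funext => x /=; rewrite -EFinM.
rewrite convolutionZr ?invr_ge0 ?(ltW Gb)//; last 2 first.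
- exact: measurable_power_kernel.
- by move=> x; exact: power_kernel_ge0.
rewrite convolution_power_kernel BetaE// -!EFinM; congr (_%:E).
rewrite /rl_kernel; move: Ga Gb Gab; move: (Gamma a) (Gamma b) (Gamma (a + b)).
by move=> x y z x0 y0 z0; field; rewrite !gt_eqF.
Qed.

Lemma convolution_rl_kernelD a b (F : R -> \bar R) t : 0 < a -> 0 < b ->
  measurable_fun setT F -> (forall x, (0 <= F x)%E) ->
  convolution (rl_kernel a) (convolution (rl_kernel b) F) t =
  convolution (rl_kernel (a + b)) F t.
Proof.
move=> a0 b0 mF F0; apply: convolutionA => //.
- exact: measurable_rl_kernel.
- exact: measurable_rl_kernel.
- by move=> x; exact: rl_kernel_ge0.
- by move=> x; exact: rl_kernel_ge0.
- by move=> x; exact: convolution_rl_kernel.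
Qed.

End rl_kernel.

(** * From the Caputo equation to a Volterra equation *)

Section primitive.
Context {R : realType}.
Notation mu := (@lebesgue_measure R).
Implicit Types (f phi k r : R -> R) (s t x nu : R).

(** The density is cut to []0, +oo[], which makes it globally measurable and zero on s <= 0, as
    convolutions need. The almost everywhere clause is Lebesgue differentiation. *)
Lemma locally_abs_continuous_primitive f : locally_abs_continuous f ->
  exists phi, [/\ measurable_fun setT phi,
    forall s, s <= 0 -> phi s = 0,
    forall t, mu.-integrable `]0, t[ (EFin \o phi),
    forall t, 0 < t -> \int[mu]_(s in `]0, t[) phi s = f t - f 0
    & forall t, {ae mu, forall x, x \in `]0, t[ -> derive1 f x = phi x}].
Proof.
move=> [phi phiP].
have iphi t : mu.-integrable `[0, t] (EFin \o phi).
  have [t0|t0] := ltP 0 t; first by have [] := phiP t t0.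
  have [+ _] := phiP 1 ltr01; apply: integrableS => //.
  by apply: subset_itvl; rewrite bnd_simp (le_trans t0).
have mphi : measurable_fun (`]0, +oo[ : set R) phi.
  rewrite (_ : `]0, +oo[%classic = \bigcup_n (`]0, (0 + n%:R)%R]%classic : set R)); last first.
    exact: itv_bndy_bigcup_BRight.
  apply/measurable_fun_bigcup => // n.
  rewrite add0r; have /integrableP[/measurable_EFinP + _] := iphi n%:R.
  by apply: measurable_funS => //; apply: subset_itvr; rewrite bnd_simp.
have E t : {in `]0, t[%classic, phi \_ `]0, +oo[ =1 phi}.
  move=> x; rewrite inE/= in_itv/= => /andP[x0 _].
  by rewrite patchE mem_set//= in_itv/= x0.
have io t : mu.-integrable `]0, t[ (EFin \o phi).
  by apply: integrableS (iphi t) => //; exact: subset_itv_oo_cc.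
exists (phi \_ `]0, +oo[); split.
- by apply/(measurable_restrictT phi (measurable_itv _)).
- by move=> s s0; rewrite patchE memNset//= in_itv/= andbT; apply/negP; rewrite -leNgt.
- move=> t; apply: eq_integrable (io t) => //.
  by move=> x xt /=; rewrite (E t).
- move=> t t0; have [_ ->] := phiP t t0; rewrite addrC addKr.
  rewrite (@eq_Rintegral _ _ _ mu _ phi); last exact: E.
  rewrite /Rintegral (@integral_itv_bndoo _ 0 t _ true false)//.
  by have /integrableP[] := io t.
- move=> t; pose psi := phi \_ `[0, t].
  have ipsi : mu.-integrable setT (EFin \o psi).
    by rewrite /psi -restrict_EFin; apply/integrable_restrict => //; rewrite setTI.
  have ifin y : mu.-integrable `[0, y] (EFin \o psi) by apply: integrableS ipsi.
  have := @FTC1 R psi (BLeft 0) ifin (open_integrable_locally openT ipsi).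
  apply: filterS; first exact: (ae_filter_ringOfSetsType mu).
  move=> x /= + /[!in_itv]/= /andP[x0 xt].
  rewrite lte_fin => /(_ x0)[dF F'].
  rewrite patchE mem_set/= ?in_itv/= ?x0// -[RHS](_ : psi x = _); last first.
    by rewrite /psi patchE mem_set//= in_itv/= !ltW.
  rewrite -F' !derive1E.
  (* A derivative at [x] only sees values near [x], and there [f] is [f 0] plus the primitive of
     [psi]. *)
  rewrite (@near_eq_derive _ _ _ f (cst (f 0) + (fun y => \int[mu]_(z in `[0, y]) psi z))).
    by rewrite deriveD// derive_cst add0r.
  near=> y.
  have y0 : 0 < y by near: y; exact: lt_nbhsr.
  have yt : y < t by near: y; exact: lt_nbhsl.
  have [_ ->] := phiP y y0; congr (_ + _); apply: eq_Rintegral => z.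
  rewrite inE/= in_itv/= => /andP[z0 zy].
  by rewrite /psi patchE mem_set//= in_itv/= z0 (le_trans zy)// ltW.
Unshelve. all: by end_near. Qed.

End primitive.

Section caputo_volterra.
Context {R : realType}.
Notation mu := (@lebesgue_measure R).
Implicit Types (f phi k r : R -> R) (s t x nu : R).

Let mitv (i : interval R) : measurable ([set` i] : set (measurableTypeR R)).
Proof. exact: measurable_itv. Qed.

(** Measurability of [G] is a separate hypothesis because almost everywhere equality does not
    transfer it for Borel sets. *)
Lemma ae_eq_integrable (D : set (measurableTypeR R)) (F G : R -> \bar R) : measurable D ->
  measurable_fun D G -> ae_eq mu D F G -> mu.-integrable D F -> mu.-integrable D G.
Proof.
move=> mD mG FG /integrableP[mF Foo]; apply/integrableP; split => //.
rewrite (@ae_eq_integral _ (measurableTypeR R) R mu D (fun x => `|F x|%E))//.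
- exact: measurableT_comp.
- exact: measurableT_comp.
- move: FG; rewrite /ae_eq; apply: filterS.
  by move=> x /= FG Dx; rewrite FG.
Qed.

Lemma ae_eq_Rintegral (D : set (measurableTypeR R)) (f g : R -> R) : measurable D ->
  measurable_fun D (EFin \o f) -> measurable_fun D (EFin \o g) ->
  ae_eq mu D (EFin \o f) (EFin \o g) ->
  \int[mu]_(x in D) f x = \int[mu]_(x in D) g x.
Proof.
move=> mD mf mg fg; rewrite /Rintegral; congr fine.
exact: (@ae_eq_integral _ (measurableTypeR R) R mu D (EFin \o g) (EFin \o f)).
Qed.

(** As [k] is nonnegative, the positive and negative parts of the product are [k] times those of
    [phi]. A signed integral thus becomes a difference of nonnegative convolutions, where Tonelli is
    available. *)
Lemma integral_convolution_signed {k phi t} :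
  measurable_fun setT k -> (forall x, 0 <= k x) ->
  (forall x, x <= 0 -> k x = 0) ->
  measurable_fun setT phi -> (forall s, s <= 0 -> phi s = 0) ->
  mu.-integrable `]0, t[ (EFin \o (fun s => k (t - s) * phi s)) ->
  [/\ convolution k (EFin \o phi^\+) t \is a fin_num,
      convolution k (EFin \o phi^\-) t \is a fin_num
    & \int[mu]_(s in `]0, t[) (k (t - s) * phi s) =
      fine (convolution k (EFin \o phi^\+) t) -
      fine (convolution k (EFin \o phi^\-) t)].
Proof.
move=> mk k0 kN mphi phiN.
set F := EFin \o _ => iF.
have Ep : convolution k (EFin \o phi^\+) t = (\int[mu]_(s in `]0%R, t[) F^\+%E s)%E.
  rewrite convolution_itv//; last by move=> s s0; rewrite /= /funrpos phiN// maxxx.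
  by apply: eq_integral => s _; rewrite funeposE /F /= /funrpos -EFinM -EFin_max maxr_pMr// mulr0.
have En : convolution k (EFin \o phi^\-) t = (\int[mu]_(s in `]0%R, t[) F^\-%E s)%E.
  rewrite convolution_itv//; last by move=> s s0; rewrite /= /funrneg phiN// oppr0 maxxx.
  apply: eq_integral => s _; rewrite funenegE /F /= /funrneg -EFinM -EFin_max.
  by rewrite maxr_pMr// mulr0 mulrN.
have fp := integrable_pos_fin_num (mitv _) iF.
have fn := integrable_neg_fin_num (mitv _) iF.
rewrite Ep En; split => //.
by rewrite /Rintegral integralE -fineB.
Qed.

Let ge0_integrable_fin f (D : set R) : measurable D -> measurable_fun D f ->
  (forall s, D s -> 0 <= f s) ->
  (\int[mu]_(s in D) (f s)%:E < +oo)%E -> mu.-integrable D (EFin \o f).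
Proof.
move=> mD mf f0 foo; apply/integrableP; split; first exact/measurable_EFinP.
rewrite (_ : integral _ _ _ = (\int[mu]_(s in D) (f s)%:E)%E)//.
by apply: eq_integral => s; rewrite inE => sD /=; rewrite ger0_norm// f0.
Qed.

(** For nu < 1, [r] is A - B with A, B the integrals of order 1 - nu of the two parts of [phi].
    Applying order nu gives their primitives by the semigroup law; these are finite, so the
    subtraction is legitimate and yields the integral of [phi]. *)
Lemma caputo_volterra nu f r t : 0 < nu -> nu <= 1 -> 0 < t ->
  locally_abs_continuous f ->
  (forall s, 0 < s -> caputo_derivable nu f s /\ caputo nu f s = r s) ->
  measurable_fun `]0, t[ r ->
  mu.-integrable `]0, t[ (EFin \o (fun s => rl_kernel nu (t - s) * r s)) /\
  \int[mu]_(s in `]0, t[) (rl_kernel nu (t - s) * r s) = f t - f 0.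
Proof.
move=> nu0 nu1 t0 /locally_abs_continuous_primitive[phi [mphi phiN iphi phiE dphi]] fr mr.
(* The case nu = 1 is separate: 1 - nu is then not a positive order. The kernel is 1 on []0, t[] and
   [r] equals [phi] almost everywhere. *)
have [nuE|nuN1] := eqVneq nu 1.
  have H : {ae mu, forall x, x \in `]0, t[ -> r x = phi x}.
    have := dphi t; apply: filterS; first exact: (ae_filter_ringOfSetsType mu).
    move=> x /= dx xt; rewrite -dx//; move: xt; rewrite in_itv/= => /andP[x0 _].
    by have [_] := fr x x0; rewrite /caputo nuE eqxx.
  have rlE s : s \in `]0, t[ -> rl_kernel nu (t - s) = 1.
    by rewrite in_itv/= => /andP[_ st]; rewrite nuE rl_kernel1 subr_gt0 st.
  have ae : ae_eq mu `]0, t[%classic (EFin \o (fun s => rl_kernel nu (t - s) * r s)) (EFin \o phi).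
    move: H; apply: filterS; first exact: (ae_filter_ringOfSetsType mu).
    by move=> x /= H xt; rewrite rlE// mul1r H.
  have mK : measurable_fun `]0, t[ (EFin \o (fun s => rl_kernel nu (t - s) * r s)).
    apply/measurable_EFinP; apply: measurable_funM => //.
    apply: measurable_funTS; apply: measurableT_comp; first exact: measurable_rl_kernel.
    exact: measurable_funB.
  have mp : measurable_fun `]0, t[ (EFin \o phi) by case/integrableP : (iphi t).
  split.
    apply: (@ae_eq_integrable _ (EFin \o phi)) => //.
    move: ae; apply: filterS.
    by move=> x /= + xt => ->.
  by rewrite -phiE//; apply: ae_eq_Rintegral.
have nu1' : 0 < 1 - nu by rewrite subr_gt0 lt_neqAle nuN1.
have mrl (a : R) : measurable_fun setT (rl_kernel a) := measurable_rl_kernel a.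
have rl0 x : 0 <= rl_kernel (1 - nu) x by exact: rl_kernel_ge0.
have rln0 x : 0 <= rl_kernel nu x by exact: rl_kernel_ge0.
have mpos : measurable_fun setT (EFin \o phi^\+).
  by apply/measurable_EFinP; exact: measurable_funrpos.
have mneg : measurable_fun setT (EFin \o phi^\-).
  by apply/measurable_EFinP; exact: measurable_funrneg.
have pos0 x : (0 <= (EFin \o phi^\+)%R x)%E by rewrite lee_fin funrpos_ge0.
have neg0 x : (0 <= (EFin \o phi^\-)%R x)%E by rewrite lee_fin funrneg_ge0.
pose A := convolution (rl_kernel (1 - nu)) (EFin \o phi^\+).
pose B := convolution (rl_kernel (1 - nu)) (EFin \o phi^\-).
have A0 x : (0 <= A x)%E by exact: convolution_ge0.
have B0 x : (0 <= B x)%E by exact: convolution_ge0.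
have mA : measurable_fun setT A by exact: measurable_convolution.
have mB : measurable_fun setT B by exact: measurable_convolution.
(* Replacing [derive1 f] by [phi] almost everywhere rewrites the Caputo derivative as a convolution;
   existence of that derivative makes both parts finite. *)
have rAB s : 0 < s -> [/\ A s \is a fin_num, B s \is a fin_num & r s = fine (A s) - fine (B s)].
  move=> s0; have [] := fr s s0; rewrite /caputo_derivable /caputo (negbTE nuN1) => iC <-.
  have mK : measurable_fun `]0, s[ (EFin \o (fun x => rl_kernel (1 - nu) (s - x) * phi x)).
    apply/measurable_EFinP; apply: measurable_funTS; apply: measurable_funM => //.
    by apply: measurableT_comp => //; exact: measurable_funB.
  pose C x := (Gamma (1 - nu))^-1 * caputo_integrand nu f s x.
  have iC' : mu.-integrable `]0, s[ (EFin \o C).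
    by have := integrableZl (mitv _) (Gamma (1 - nu))^-1 iC.
  have ae : ae_eq mu `]0, s[%classic (EFin \o C)
      (EFin \o (fun x => rl_kernel (1 - nu) (s - x) * phi x)).
    have := dphi s; apply: filterS; first exact: (ae_filter_ringOfSetsType mu).
    move=> x /= dx xs; rewrite /C /caputo_integrand dx// /rl_kernel.
    move: xs; rewrite /= in_itv/= => /andP[_ xs].
    by rewrite power_kernelE ?subr_gt0// (addrC 1) addrK mulrA.
  have mC : measurable_fun `]0, s[ (EFin \o C) by case/integrableP: iC'.
  have iK : mu.-integrable `]0, s[ (EFin \o (fun x => rl_kernel (1 - nu) (s - x) * phi x)).
    by apply: (@ae_eq_integrable `]0, s[%classic (EFin \o C)).
  have [fA fB AB] := integral_convolution_signed (mrl _) rl0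
    (@rl_kernel_le0 R _) mphi phiN iK.
  by split => //; rewrite -AB -RintegralZl//; apply: (@ae_eq_Rintegral _ C).
have i1 : mu.-integrable `]0, t[ (EFin \o (fun s => rl_kernel 1 (t - s) * phi s)).
  apply: eq_integrable (iphi t) => // s; rewrite inE/= in_itv/= => /andP[_ st].
  by rewrite rl_kernel1 subr_gt0 st mul1r.
have [fp fn phint] := integral_convolution_signed (mrl 1)
  (fun x => rl_kernel_ge0 1 x ltr01) (@rl_kernel_le0 R _) mphi phiN i1.
have nuD : nu + (1 - nu) = 1 by rewrite addrC subrK.
have Ep : convolution (rl_kernel nu) A t = convolution (rl_kernel 1) (EFin \o phi^\+) t.
  rewrite -[in RHS]nuD; exact: convolution_rl_kernelD.
have En : convolution (rl_kernel nu) B t = convolution (rl_kernel 1) (EFin \o phi^\-) t.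
  rewrite -[in RHS]nuD; exact: convolution_rl_kernelD.
have Ale0 s : s <= 0 -> A s = 0%E.
  move=> s0; rewrite /A convolution_itv.
  - by rewrite set_itv_ge ?integral_set0// bnd_simp -leNgt.
  - by move=> x; exact: rl_kernel_le0.
  - by move=> x x0 /=; rewrite /funrpos phiN// maxxx.
have Ble0 s : s <= 0 -> B s = 0%E.
  move=> s0; rewrite /B convolution_itv.
  - by rewrite set_itv_ge ?integral_set0// bnd_simp -leNgt.
  - by move=> x; exact: rl_kernel_le0.
  - by move=> x x0 /=; rewrite /funrneg phiN// oppr0 maxxx.
(* Return from extended to real integrals: for a nonnegative [D], a finite convolution at [t] is
   integrability. *)
have iConv (D : R -> \bar R) : measurable_fun setT D -> (forall x, (0 <= D x)%E) ->
    (forall s, s <= 0 -> D s = 0%E) -> (forall s, 0 < s -> D s \is a fin_num) ->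
    convolution (rl_kernel nu) D t \is a fin_num ->
    mu.-integrable `]0, t[ (EFin \o (fun s => rl_kernel nu (t - s) * fine (D s))) /\
    \int[mu]_(s in `]0, t[) (rl_kernel nu (t - s) * fine (D s)) =
      fine (convolution (rl_kernel nu) D t).
  move=> mD D0 Dle0 Dfin.
  rewrite convolution_itv//; last by move=> x; exact: rl_kernel_le0.
  have -> : (\int[mu]_(s in `]0%R, t[) ((rl_kernel nu (t - s))%:E * D s) =
     \int[mu]_(s in `]0%R, t[) (rl_kernel nu (t - s) * fine (D s))%:E)%E.
    apply: eq_integral => s; rewrite inE/= in_itv/= => /andP[s0 _].
    by rewrite -{1}(fineK (Dfin _ s0)).
  move=> Dconv; split => //.
  apply: ge0_integrable_fin => //.
  - apply: measurable_funTS; apply: measurable_funM.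
      by apply: measurableT_comp => //; exact: measurable_funB.
    exact: measurableT_comp.
  - by move=> s _; rewrite mulr_ge0// fine_ge0.
  - by rewrite ltey_eq Dconv.
have [s /rAB[]//||iA EA] := iConv A mA A0 Ale0; first by rewrite Ep.
have [s /rAB[]//||iB EB] := iConv B mB B0 Ble0; first by rewrite En.
have iAB := integrableB (mitv _) iA iB.
have ABE : {in `]0, t[%classic,
    (fun s => rl_kernel nu (t - s) * fine (A s) - rl_kernel nu (t - s) * fine (B s)) =1
    (fun s => rl_kernel nu (t - s) * r s)}.
  move=> s; rewrite inE/= in_itv/= => /andP[s0 _].
  by have [_ _ ->] := rAB s s0; rewrite mulrBr.
split.
  apply: eq_integrable iAB => // s st /=.
  by rewrite -EFinB ABE.
transitivity (\int[mu]_(s in `]0, t[)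
    (rl_kernel nu (t - s) * fine (A s) - rl_kernel nu (t - s) * fine (B s))).
  by apply: eq_Rintegral => s st; rewrite -ABE.
rewrite RintegralB// EA EB Ep En -phint -phiE//.
apply: eq_Rintegral => s; rewrite inE/= in_itv/= => /andP[_ st].
by rewrite rl_kernel1 subr_gt0 st mul1r.
Qed.

End caputo_volterra.

(** * The Mittag-Leffler function *)

Section mittag_leffler.
Context {R : realType}.
Notation mu := (@lebesgue_measure R).
Implicit Types (nu lam t : R).

Lemma cvg_mittag_leffler_term {nu y : R} : 0 < nu -> 0 <= y ->
  y ^+ n / Gamma (nu * n%:R + 1) @[n --> \oo] --> 0.
Proof.
(* [Gamma_ge] at this K: K^nu > 2 y beats the geometric growth of y^n. *)
move=> nu0 y0; pose z := 2 * (y + 1); pose K := z `^ nu^-1.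
have z0 : 0 < z by rewrite /z; lra.
have K0 : 0 < K by exact: powR_gt0.
have bound n : 0 <= y ^+ n / Gamma (nu * n%:R + 1) <= expR (K + 1) * 2^-1 ^+ n.
  have n1 : 1 <= nu * n%:R + 1 by rewrite lerDr mulr_ge0// ltW.
  have G0 : 0 < Gamma (nu * n%:R + 1) by apply: Gamma_gt0; exact: lt_le_trans n1.
  rewrite divr_ge0 ?exprn_ge0 ?(ltW G0)//= ler_pdivrMr//.
  have := Gamma_ge K0 n1; rewrite addrK.
  have -> : K `^ (nu * n%:R) = z ^+ n.
    rewrite /K -powRrM mulrA mulVf ?gt_eqF// mul1r powR_mulrn//; exact: ltW.
  (* The exponentials cancel, leaving (z/2)^n = (y + 1)^n, which dominates y^n. *)
  move=> Gge; apply: (@le_trans _ _ (expR (K + 1) * 2^-1 ^+ n * (z ^+ n * expR (- (K + 1))))).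
    rewrite [leRHS](_ : _ = (2^-1 * z) ^+ n); last first.
      rewrite [in RHS]exprMn expRN; move: (expR (K + 1)) (expR_gt0 (K + 1)) => e e0.
      by move: (2^-1 ^+ n) (z ^+ n) => q w; field; rewrite gt_eqF.
    by apply: lerXn2r; rewrite ?nnegrE// /z; lra.
  by rewrite ler_wpM2l// mulr_ge0 ?expR_ge0// exprn_ge0.
apply: (@squeeze_cvgr _ _ _ _ (fun=> 0) (fun n => expR (K + 1) * 2^-1 ^+ n)).
- by apply: nearW => n.
- exact: cvg_cst.
- rewrite -[X in _ --> X](mulr0 (expR (K + 1))); apply: cvgM; first exact: cvg_cst.
  by apply: cvg_expr; rewrite ger0_norm// invf_lt1// ltr1n.
Qed.

(** Nonnegativity of [G] bounds the iterated integrals, in place of a contraction or Gronwall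
    argument. Convergence of the Mittag-Leffler series comes out of the telescoping when [G0] is
    nonzero. *)
Lemma volterra_mittag_leffler nu lam (G : R -> R) (G0 : R) t :
  0 < nu -> 0 <= lam ->
  measurable_fun (`]0, +oo[ : set R) G -> (forall s : R, 0 < s -> 0 <= G s) ->
  (forall s : R, 0 < s ->
     mu.-integrable `]0, s[ (EFin \o (fun x => rl_kernel nu (s - x) * G x)) /\
     G s + lam * \int[mu]_(x in `]0, s[) (rl_kernel nu (s - x) * G x) = G0) ->
  0 < t -> G t = G0 * mittag_leffler nu 1 (- lam * t `^ nu).
Proof.
move=> nu0 lam0 mG G_ge0 Geq t0.
pose H : R -> R := G \_ `]0, +oo[.
have HE (s : R) : 0 < s -> H s = G s.
  by move=> s0; rewrite /H patchE mem_set//= in_itv/= s0.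
have HN (s : R) : s <= 0 -> H s = 0.
  by move=> s0; rewrite /H patchE memNset//= in_itv/= andbT; apply/negP; rewrite -leNgt.
have mH : measurable_fun setT (EFin \o H).
  by apply/measurable_EFinP/(measurable_restrictT G (measurable_itv _)).
have H0 (s : R) : 0 <= H s.
  by have [/HN ->//|s0] := leP s 0; rewrite HE// G_ge0.
have H0E (s : R) : (0 <= (EFin \o H) s)%E by rewrite lee_fin.
have rl0 (a : R) : 0 < a -> forall x, 0 <= rl_kernel a x.
  by move=> a0 x; exact: rl_kernel_ge0.
have mrl (a : R) : measurable_fun setT (rl_kernel a) := measurable_rl_kernel a.
pose a (n : nat) := nu * n%:R.
have a0 n : 0 < a n.+1 by rewrite mulr_gt0.
have aS n : a n.+1 + nu = a n.+2 by rewrite /a -[in RHS]natr1 mulrDr mulr1.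
pose c n := convolution (rl_kernel (a n)) (EFin \o H).
have c0 n (s : R) : (0 <= c n.+1 s)%E by apply: convolution_ge0 => //; exact: rl0.
(* The equation at any positive time, here 1, shows [G0] as a sum of nonnegative terms. *)
have G00 : 0 <= G0.
  have [_ <-] := Geq 1 ltr01; rewrite addr_ge0 ?G_ge0// mulr_ge0//.
  apply: Rintegral_ge0 => x; rewrite /= in_itv/= => /andP[x0 x1].
  by rewrite mulr_ge0 ?G_ge0// rl_kernel_ge0.
have step0 (s : R) : ((EFin \o H) s + lam%:E * c 1%N s = (G0 * rl_kernel 1 s)%:E)%E.
  rewrite /= rl_kernel1 /c /a mulr1 convolution_itv.
  - have [s0|s0] := leP s 0.
      by rewrite HN// set_itv_ge ?integral_set0 ?mule0 ?adde0 ?mulr0// bnd_simp -leNgt.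
    have [iG] := Geq s s0; rewrite mulr1 -HE// => <-.
    rewrite EFinD EFinM; congr (_ + _ * _)%E.
    rewrite /Rintegral fineK; last exact: integrable_fin_num iG.
    by apply: eq_integral => x; rewrite inE/= in_itv/= => /andP[x0 _]; rewrite HE// EFinM.
  - by move=> x; exact: rl_kernel_le0.
  - by move=> x x0 /=; rewrite HN.
have cS n (s : R) : convolution (rl_kernel (a n.+1)) (c 1%N) s = c n.+2 s.
  have aE : a 1%N = nu by rewrite /a mulr1.
  by rewrite /c -aS aE convolution_rl_kernelD.
(* This is [step0] convolved with the kernel of order [a n.+1]. *)
have stepS n (s : R) : (c n.+1 s + lam%:E * c n.+2 s = (G0 * rl_kernel (a n.+1 + 1) s)%:E)%E.
  have mc1 : measurable_fun setT (c 1%N).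
    by apply: measurable_convolution => //; exact: rl0.
  have rla := rl0 _ (a0 n).
  have mlc : measurable_fun setT (fun x => lam%:E * c 1%N x)%E by exact: measurable_funeM.
  have lc0 x : (0 <= lam%:E * c 1%N x)%E by rewrite mule_ge0// lee_fin.
  have FE : ((EFin \o H) \+ (fun x => lam%:E * c 1%N x))%E =
      (fun x => G0%:E * (EFin \o rl_kernel 1) x)%E.
    by apply/funext => x; rewrite [LHS]step0 EFinM.
  have -> : (c n.+1 s + lam%:E * c n.+2 s)%E =
      convolution (rl_kernel (a n.+1)) (fun x => G0%:E * (EFin \o rl_kernel 1) x)%E s.
    rewrite -FE.
    by rewrite convolutionD// convolutionZr// cS.
  have mr1 : measurable_fun setT (EFin \o rl_kernel (1 : R)) by exact/measurable_EFinP.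
  rewrite convolutionZr//; last by move=> x; rewrite lee_fin rl0.
  by rewrite convolution_rl_kernel// EFinM.
(* Order 0 is the identity, which no kernel function represents, so [u 0] is set apart. *)
pose u n := if n is 0%N then (EFin \o H) t else c n t.
have u0 n : (0 <= u n)%E by case: n => [|n]; rewrite /u.
have ustep n : (u n + lam%:E * u n.+1 = (G0 * (t `^ nu) ^+ n / Gamma (a n + 1))%:E)%E.
  have -> : G0 * (t `^ nu) ^+ n / Gamma (a n + 1) = G0 * rl_kernel (a n + 1) t.
    rewrite /rl_kernel power_kernelE// addrK /a powRrM powR_mulrn ?powR_ge0//.
    by rewrite (mulrC _^-1) mulrA.
  by case: n => [|n]; [rewrite /a mulr0 add0r; exact: step0|exact: stepS].
pose b n := G0 * (t `^ nu) ^+ n / Gamma (a n + 1).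
have ufin n : u n \is a fin_num.
  rewrite ge0_fin_numE// (@le_lt_trans _ _ (b n)%:E) ?ltry//.
  by rewrite -ustep leeDl// mule_ge0.
pose v n := fine (u n).
have v0 n : 0 <= v n by exact: fine_ge0.
have vstep n : v n + lam * v n.+1 = b n.
  by apply: EFin_inj; rewrite EFinD EFinM /v !fineK.
pose S := series (fun j : nat => (- lam * t `^ nu) ^+ j / Gamma (nu * j%:R + 1)).
(* Telescoping: by [vstep] the n-th term is (-lam)^n v_n - (-lam)^(n+1) v_(n+1). *)
have SE n : G0 * S n = G t - (- lam) ^+ n * v n.
  rewrite /S /series/=; elim: n => [|n IH].
    by rewrite big_geq// mulr0 expr0 mul1r /v /u/= HE// subrr.
  rewrite big_nat_recr//= mulrDr IH.
  have -> : G0 * ((- lam * t `^ nu) ^+ n / Gamma (nu * n%:R + 1)) = (- lam) ^+ n * b n.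
    by rewrite /b /a exprMn -!mulrA mulrCA.
  by rewrite -vstep exprS; ring.
have rem0 : (- lam) ^+ n * v n @[n --> \oo] --> 0.
  have y0 : 0 <= lam * t `^ nu by rewrite mulr_ge0// powR_ge0.
  have cvt := cvg_mittag_leffler_term nu0 y0.
  have cvb : G0 * ((lam * t `^ nu) ^+ n / Gamma (nu * n%:R + 1)) @[n --> \oo] --> 0.
    by rewrite -[X in _ --> X](mulr0 G0); apply: cvgM => //; exact: cvg_cst.
  apply/cvgr0Pnorm_le => e e0.
  near=> n; rewrite normrM normrX normrN (ger0_norm lam0) (ger0_norm (v0 n)).
  (* Dropping the nonnegative [lam * v n.+1] from [vstep] gives v_n <= b_n. *)
  apply: (@le_trans _ _ (G0 * ((lam * t `^ nu) ^+ n / Gamma (nu * n%:R + 1)))).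
    rewrite exprMn -mulrA mulrCA ler_wpM2l ?exprn_ge0//.
    by rewrite mulrA -/(b n) -vstep lerDl mulr_ge0.
  by apply: le_trans (ler_norm _) _; near: n; exact: (cvgr0_norm_le _ cvb).
have cvS : G0 * S n @[n --> \oo] --> G t.
  rewrite (_ : (fun n => _) = (fun n => G t - (- lam) ^+ n * v n)); last exact/funext.
  by rewrite -[X in _ --> X]subr0; apply: cvgB => //; exact: cvg_cst.
(* The limit of [S] is found by dividing by [G0]; if [G0] is 0, the sequence [G0 * S n] is
   constantly 0 and so is its limit [G t]. *)
have [G0E|G0N] := eqVneq G0 0.
  rewrite G0E mul0r; apply: (cvg_unique (@Rhausdorff R) cvS).
  by rewrite (_ : (fun n => _) = cst 0); [exact: cvg_cst|apply/funext => n; rewrite G0E mul0r].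
rewrite /mittag_leffler -/S.
have -> : limn S = G0^-1 * G t.
  apply/cvg_lim => //; rewrite (_ : S = (fun n => G0^-1 * (G0 * S n))).
    by apply: cvgM => //; exact: cvg_cst.
  by apply/funext => n; rewrite mulrA mulVf// mul1r.
by rewrite mulrA divff// mul1r.
Unshelve. all: by end_near. Qed.

End mittag_leffler.

(** * Moments of the death process *)

(** On the half-line [f] is [f 0] plus a difference of order 1 convolutions, which are measurable by
    Tonelli. *)
Lemma locally_abs_continuous_measurable {R : realType} (f : R -> R) :
  locally_abs_continuous f -> measurable_fun (`]0, +oo[ : set R) f.
Proof.
move=> /locally_abs_continuous_primitive[phi [mphi phiN iphi phiE _]].
pose c (g : R -> R) t := fine (convolution (rl_kernel 1) (EFin \o g) t).
have rl0 x : 0 <= rl_kernel (1 : R) x by exact: rl_kernel_ge0.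
have mrl : measurable_fun setT (rl_kernel (1 : R)) := measurable_rl_kernel 1.
have mc (g : R -> R) : measurable_fun setT g -> (forall x, 0 <= g x) ->
    measurable_fun (`]0, +oo[ : set R) (c g).
  move=> mg g0; apply: measurable_funTS; apply: measurableT_comp => //.
  by apply: measurable_convolution => //; exact/measurable_EFinP.
apply: (eq_measurable_fun (fun t => c phi^\+ t - c phi^\- t + f 0)) => [t|].
  rewrite inE/= in_itv/= andbT => t0.
  have i1 : (@lebesgue_measure R).-integrable `]0, t[
      (EFin \o (fun s => rl_kernel 1 (t - s) * phi s)).
    apply: eq_integrable (iphi t) => // s; rewrite inE/= in_itv/= => /andP[_ st].
    by rewrite rl_kernel1 subr_gt0 st mul1r.
  have [_ _ phint] := integral_convolution_signed mrl rl0
    (@rl_kernel_le0 R 1) mphi phiN i1.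
  rewrite /c -phint; apply/esym/eqP; rewrite -subr_eq -(phiE _ t0); apply/eqP.
  apply: eq_Rintegral => s; rewrite inE/= in_itv/= => /andP[_ st].
  by rewrite rl_kernel1 subr_gt0 st mul1r.
apply: measurable_funD => //; apply: measurable_funB; apply: mc.
- exact: measurable_funrpos.
- by move=> x; exact: funrpos_ge0.
- exact: measurable_funrneg.
- by move=> x; exact: funrneg_ge0.
Qed.

Section death_moments.
Context {R : realType}.
Notation lebesgue := (@lebesgue_measure R).
Implicit Types (nu mu m t : R) (n k : nat) (w : nat -> R) (p : nat -> R -> R).

(** Summation by parts: p_(k+1) is fed by level k and drained at level k + 1, so the weights enter
    through k (w_k - w_(k-1)). At k = 0 the hypothesis says m w_0 = 0. *)
Let sum_death_rate mu m n w (q : nat -> R) :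
  (forall k, k%:R * (w k - w k.-1) = m * w k) ->
  \sum_(k < n.+1) w k * (mu * k.+1%:R * q k.+1 - mu * k%:R * q k) =
  mu * n.+1%:R * w n * q n.+1 - m * mu * \sum_(k < n.+1) w k * q k.
Proof.
move=> wm; elim: n => [|n IH].
  rewrite !big_ord1/=; have := wm 0%N; rewrite mul0r => w0.
  have -> : m * mu * (w 0%N * q 0%N) = mu * q 0%N * (m * w 0%N) by ring.
  by rewrite -w0; ring.
rewrite big_ord_recr [in RHS]big_ord_recr IH/=.
have -> : m * mu * (\sum_(i < n.+1) w i * q i + w n.+1 * q n.+1) =
    m * mu * (\sum_(i < n.+1) w i * q i) + mu * q n.+1 * (m * w n.+1) by ring.
by rewrite -wm/=; ring.
Qed.

(* The condition on w makes it an eigenvector of the transposed generator, for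
   the eigenvalue - m * mu; the falling factorial of order m satisfies it. *)
Lemma death_moment nu mu m n p w t : 0 < nu -> nu <= 1 -> 0 < mu -> 0 < m ->
  fractional_death_system nu mu n p ->
  (forall k s, 0 < s -> 0 <= p k s) -> (forall k, 0 <= w k) ->
  (forall k, k%:R * (w k - w k.-1) = m * w k) -> 0 < t ->
  \sum_(k < n.+1) w k * p k t = w n * mittag_leffler nu 1 (- (m * mu) * t `^ nu).
Proof.
move=> nu0 nu1 mu0 m0 [ac sys pS pn p0] p_ge0 w0 wm t0.
have mmu0 : 0 < m * mu by rewrite mulr_gt0.
have mp k : (k <= n.+1)%N -> measurable_fun (`]0, +oo[ : set R) (p k).
  rewrite leq_eqVlt => /predU1P[->|kn]; last exact: locally_abs_continuous_measurable (ac _ _).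
  apply: (eq_measurable_fun (fun=> 0 : R)) => [x|]; last exact: measurable_cst.
  by rewrite inE/= in_itv/= andbT => x0; rewrite pS// ltW.
pose G s := \sum_(k < n.+1) w k * p k s.
pose r k s := mu * k.+1%:R * p k.+1 s - mu * k%:R * p k s.
have volt (k : 'I_n.+1) s : 0 < s ->
    lebesgue.-integrable `]0, s[ (EFin \o (fun x => rl_kernel nu (s - x) * r k x)) /\
    \int[lebesgue]_(x in `]0, s[) (rl_kernel nu (s - x) * r k x) = p k s - p k 0.
  move=> s0; apply: caputo_volterra => //.
  - by apply: ac; rewrite -ltnS.
  - by move=> x x0; apply: sys => //; rewrite -ltnS.
  - apply: (@measurable_funS _ _ _ _ (`]0, +oo[ : set R)) => //.
      by apply: subset_itvl.
    by apply: measurable_funB; apply: measurable_funM => //; apply: mp => //; exact: ltnW.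
(* The boundary term of [sum_death_rate] disappears because p_(n+1) is 0. *)
have rE s x : 0 < x -> \sum_(k < n.+1) w k * (rl_kernel nu (s - x) * r k x) =
    - (m * mu) * (rl_kernel nu (s - x) * G x).
  move=> x0; under eq_bigr do rewrite mulrCA.
  rewrite -mulr_sumr /r (sum_death_rate _ _ _ _ (fun k => p k x) wm) pS ?ltW// mulr0 sub0r.
  by rewrite mulrN mulNr mulrCA.
rewrite -/(G t); apply: volterra_mittag_leffler => //.
- exact: ltW.
- apply: measurable_sum => k; apply: measurable_funM => //.
  by apply: mp; exact: ltnW.
- by move=> s s0; apply: sumr_ge0 => k _; rewrite mulr_ge0// p_ge0.
move=> s s0.
have mI : measurable (`]0, s[ : set (measurableTypeR R)) by exact: measurable_itv.
have iw (k : 'I_n.+1) : lebesgue.-integrable `]0, s[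
    (EFin \o (fun x => w k * (rl_kernel nu (s - x) * r k x))).
  have [ik _] := volt k s s0.
  exact: (integrableZl mI (w k) ik).
have iS : lebesgue.-integrable `]0, s[
    (EFin \o (fun x => \sum_(k < n.+1) w k * (rl_kernel nu (s - x) * r k x))).
  rewrite (_ : EFin \o _ = (fun x => \sum_(k < n.+1) (w k * (rl_kernel nu (s - x) * r k x))%:E)%E).
    by apply: integrable_sum => // k _; exact: iw.
  by apply/funext => x /=; rewrite sumEFin.
have intS : \int[lebesgue]_(x in `]0, s[)
    (\sum_(k < n.+1) w k * (rl_kernel nu (s - x) * r k x)) = G s - w n.
  apply: EFin_inj; rewrite /Rintegral fineK; last exact: (integrable_fin_num _ iS).
  under eq_integral do rewrite -sumEFin.
  rewrite integral_sum//.
  (* At time 0 only the state n has mass, so the initial moment is [w n]. *)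
  rewrite (_ : w n = \sum_(k < n.+1) w k * p k 0); last first.
    rewrite big_ord_recr/= pn mulr1 big1 ?add0r// => k _.
    by rewrite p0// mulr0.
  rewrite -sumrB -sumEFin; apply: eq_bigr => k _.
  rewrite -mulrBr; have [ik <-] := volt k s s0.
  rewrite -RintegralZl// /Rintegral fineK//.
  exact: (integrable_fin_num _ (iw k)).
have iG : lebesgue.-integrable `]0, s[ (EFin \o (fun x => rl_kernel nu (s - x) * G x)).
  have := integrableZl mI (- (m * mu))^-1 iS.
  apply: eq_integrable => // x; rewrite inE/= in_itv/= => /andP[x0 _].
  by rewrite rE// -EFinM mulKf// oppr_eq0 gt_eqF.
split => //.
have : \int[lebesgue]_(x in `]0, s[) (- (m * mu) * (rl_kernel nu (s - x) * G x)) = G s - w n.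
  rewrite -intS; apply: eq_Rintegral => x; rewrite inE/= in_itv/= => /andP[x0 _].
  by rewrite rE.
rewrite RintegralZl// => H.
by rewrite -[X in X + _](subrK (w n)) -H mulNr addrAC addNr add0r.
Qed.

End death_moments.

(** [h \o X] is a finite combination of indicators of the level sets of [X]. With [h] nonnegative,
    additivity of the integral needs no integrability. *)
Lemma expectation_finite_range d (T : measurableType d) (R : realType)
    (P : probability T R) (X : {RV P >-> R}) (n : nat) (h : R -> R) :
  (forall w, exists2 k : nat, (k <= n)%N & X w = k%:R) ->
  (forall x, 0 <= h x) ->
  ('E_P[h \o X] = (\sum_(k < n.+1) h k%:R * fine (P [set w | X w = k%:R]))%:E)%E.
Proof.
move=> Xn h0; rewrite unlock.
pose A k := [set w | X w = k%:R].
have mA k : measurable (A k).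
  exact: (measurable_funPTI X (measurable_set1 (k%:R : R))).
transitivity (\int[P]_w (\sum_(k < n.+1) ((h k%:R)%:E * (\1_(A k) w)%:E)))%E.
  apply: eq_integral => w _; have [k kn Xw] := Xn w.
  rewrite (bigD1 (Ordinal (kn : (k < n.+1)%N)))//= big1 ?adde0; last first.
    move=> i ik; rewrite indicE memNset ?mule0//= /A/= Xw => /eqP.
    rewrite eqr_nat => /eqP ki; case/negP: ik; apply/eqP/val_inj => /=.
    by rewrite ki.
  by rewrite indicE mem_set// mule1 Xw.
rewrite ge0_integral_sum//; last 2 first.
- by move=> k; apply: emeasurable_funM => //; apply/measurable_EFinP.
- by move=> k w _; rewrite mule_ge0// lee_fin.
rewrite -sumEFin; apply: eq_bigr => k _.
rewrite ge0_integralZl_EFin//; last by apply/measurable_EFinP.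
by rewrite integral_indic// setIT EFinM fineK//; apply: fin_num_measure; exact: mA.
Qed.

Theorem mainTheorem3 (R : realType) (d : measure_display)
  (T : measurableType d) (P : probability T R)
  (nu mu : R) (n0 : nat) (M : R -> {RV P >-> R})
  (nu_gt0 : 0 < nu) (nu_le1 : nu <= 1) (mu_gt0 : 0 < mu) (n0_ge1 : (1 <= n0)%N)
  (M_death : fractional_linear_death_process nu mu n0 M)
  (t : R) (t_gt0 : 0 < t) :
  'V_P[M t] =
    (n0%:R * (n0%:R - 1) * mittag_leffler nu 1 (- 2 * mu * t `^ nu)
     + n0%:R * mittag_leffler nu 1 (- mu * t `^ nu)
     - n0%:R ^+ 2 * mittag_leffler nu 1 (- mu * t `^ nu) ^+ 2)%:E.
Proof.
have [Mn sys] := M_death; pose p k := state_probability M k t.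
have p_ge0 k s : 0 <= state_probability M k s by exact: fine_ge0.
(* Weights w_k = k with m = 1. *)
have E1 : \sum_(k < n0.+1) k%:R * p k = n0%:R * mittag_leffler nu 1 (- mu * t `^ nu).
  rewrite (@death_moment _ nu mu 1 n0 (state_probability M) (fun k => k%:R))// ?mul1r//.
  case=> [|k]; first by rewrite !mul0r mulr0.
  by rewrite -natrB// subSn// subnn mulr1 mul1r.
(* Weights w_k = k (k - 1) with m = 2, as k (k (k - 1) - (k - 1)(k - 2)) = 2 k (k - 1). *)
have E2 : \sum_(k < n0.+1) (k%:R * (k%:R - 1)) * p k =
    n0%:R * (n0%:R - 1) * mittag_leffler nu 1 (- 2 * mu * t `^ nu).
  rewrite (@death_moment _ nu mu 2 n0 (state_probability M)
    (fun k => k%:R * (k%:R - 1)))// ?mulNr//.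
  - by case=> [|k]; rewrite ?mul0r// -natr1 addrK mulr_ge0.
  - by case=> [|k]; rewrite ?mul0r ?mulr0//= -!natr1; ring.
have Mt w : exists2 k : nat, (k <= n0)%N & M t w = k%:R by apply: Mn; exact: ltW.
have p1 : \sum_(k < n0.+1) p k = 1.
  have := @expectation_finite_range _ _ _ _ (M t) n0 (cst 1) Mt (fun=> ler01).
  rewrite (_ : cst 1 \o M t = cst 1)// expectation_cst => -[->].
  by apply: eq_bigr => k _; rewrite mul1r.
have EM : ('E_P[M t] = (\sum_(k < n0.+1) k%:R * p k)%:E)%E.
  (* The absolute value supplies a function nonnegative on all of [R] that leaves [M t]
     unchanged. *)
  rewrite -(_ : (fun x => `|x|) \o M t = M t).
    rewrite (@expectation_finite_range _ _ _ _ (M t) n0)//.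
    by congr (_%:E); apply: eq_bigr => k _; rewrite ger0_norm.
  by apply/funext => w /=; have [k _ ->] := Mt w; rewrite ger0_norm.
rewrite /variance unlock EM/=; set c := \sum_(k < n0.+1) _.
rewrite (_ : _ * _ = (fun x => (x - c) ^+ 2) \o M t); last first.
  by apply/funext => w; rewrite /= expr2.
rewrite (@expectation_finite_range _ _ _ _ (M t) n0)//; last by move=> x; exact: sqr_ge0.
congr (_%:E); rewrite -E2 -E1 -/c.
(* Uses (k - c)^2 = k (k - 1) + (1 - 2 c) k + c^2, where the middle sum is [c] itself and the last
   has total mass 1. *)
transitivity (\sum_(k < n0.+1) (k%:R * (k%:R - 1) * p k) + (1 - 2 * c) * c +
    c ^+ 2 * \sum_(k < n0.+1) p k).
  have: c = \sum_(k < n0.+1) k%:R * p k by [].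
  move: c => c cE; rewrite [X in _ + _ * X + _]cE !mulr_sumr -!big_split/=.
  by apply: eq_bigr => k _; rewrite -[fine _]/(p k); ring.
by rewrite p1 -exprMn -E1 -/c; ring.
Qed.
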